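(* The locale map $c\colon 2^\omega\to\mathbb{I}$ is a proper surjection, and the preframe homomorphism $\forall_c\colon\Omega 2^\omega\to\Omega\mathbb{I}$ determined by $\forall_c(s,t)=\theta(s,t)$ for $(s,t)\in S$ is the right adjoint of $c^\ast$.
   Context: Write $2=\{-,+\}$ (discrete). Cantor space $2^\omega$ is the locale of streams (indexed by $1,2,3,\dots$) of signs; $2^\ast$ is the set of finite sign sequences, $\varepsilon$ the empty sequence, $\sqsubseteq$ the prefix order, and juxtaposition denotes concatenation. For $s\in2^\ast$, $\uparrow s$ is the open of $2^\omega$ of those streams with prefix $s$; these form a base. $\mathbb{I}=[-1,1]$ is the locale of Dedekind reals in the closed interval. $\Omega X$ is the frame of a locale $X$. The map $c\colon 2^\omega\to\mathbb{I}$ is the unique locale map with $c(\pm s)=\frac12(\pm1+c(s))$; on streams, $c((s_i)_{i\ge1})=\sum_{i\ge1}s_i2^{-i}$, where $\pm$ is read as $\pm1$. A locale map $f\colon X\to Y$ is a surjection if $f^\ast\colon\Omega Y\to\Omega X$ is injective, and is proper if the right adjoint $\forall_f\colon\Omega X\to\Omega Y$ of $f^\ast$ preserves directed joins and satisfies the Frobenius condition $\forall_f(a\vee f^\ast b)=\forall_f a\vee b$. A preframe homomorphism is a function preserving finite meets and directed joins. For $s,t\in2^\ast$: $s<t$ means that there is $u$ with $u-\sqsubseteq s$ and $u+\sqsubseteq t$; $s\leqslant t$ means $s<t$ or $s\sqsubseteq t$; $s\eqslantless t$ means $s<t$ or $t\sqsubseteq s$. A right bristle of $s$ is a sequence $t+$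 with $t-\sqsubseteq s$; a left bristle of $s$ is a sequence $t-$ with $t+\sqsubseteq s$. Put $\upharpoonright s=\uparrow s\vee\bigvee\{\uparrow t\mid t\text{ a right bristle of }s\}$ and $\upharpoonleft s=\uparrow s\vee\bigvee\{\uparrow t\mid t\text{ a left bristle of }s\}$. $S=S_{\upharpoonleft}\times S_{\upharpoonright}$, where $S_{\upharpoonright}=2^\ast\cup\{\bot\}$ with $2^\ast$ ordered by the reverse of $\leqslant$ and $\bot$ an adjoined bottom, and $S_{\upharpoonleft}=2^\ast\cup\{\bot\}$ with $2^\ast$ ordered by $\eqslantless$ and $\bot$ an adjoined bottom. An element $(s,t)\in S$ is interpreted as the open $\upharpoonleft s\vee\upharpoonright t$ of $2^\omega$, where $\upharpoonleft\bot=\upharpoonright\bot=\emptyset$. These opens form a preframe base of $\Omega2^\omega$ (every open is a directed join of finite meets of them). For $s,t\in2^\ast$, $s\between t$ means: (i) $t<s$, or (ii) $t\sqsubseteq s$, or (iii) $s\sqsubseteq t$, or (iv) $s=u-+^k$ and $t=u+-^l$ for some $u\in 2^\ast$ and $k,l\ge0$. $\theta_{\upharpoonright}\colon S_{\upharpoonright}\to\Omega\mathbb{I}$: $\theta_{\upharpoonright}(t)=\mathbb{I}$ if $t\in2^\ast$ contains no $+$; $\theta_{\upharpoonright}(t)=(c(t-^\omega),1]$ if $t\in2^\ast$ contains a $+$; $\theta_{\upharpoonright}(\bot)=\emptyset$. Dually $\theta_{\upharpoonleft}(s)=\mathbb{I}$ if $s\in2^\ast$ contains no $-$; $\theta_{\upharpoonleft}(s)=[-1,c(s+^\omega))$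 if $s\in2^\ast$ contains a $-$; $\theta_{\upharpoonleft}(\bot)=\emptyset$. Then $\theta\colon S\to\Omega\mathbb{I}$ is given by $\theta(s,t)=\mathbb{I}$ if $s,t\in2^\ast$ and $s\between t$, and $\theta(s,t)=\theta_{\upharpoonleft}(s)\vee\theta_{\upharpoonright}(t)$ otherwise. There is a (unique) preframe homomorphism $\forall_c\colon\Omega2^\omega\to\Omega\mathbb{I}$ taking the open $(s,t)$ to $\theta(s,t)$ for all $(s,t)\in S$. *)

(* Defs.v *)
From mathcomp Require Import all_boot all_order all_algebra.
From mathcomp Require Import boolp classical_sets.
From mathcomp Require Import ring lra.

Set Implicit Arguments.
Unset Strict Implicit.
Unset Printing Implicit Defensive.

Import Order.TTheory GRing.Theory Num.Theory.
Local Open Scope classical_set_scope.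
Local Open Scope ring_scope.

(** * Locales *)

(* A locale is given by its frame of opens; [ojoin A] is the join of the
   family [A] of opens. *)
Record locale := Locale {
  opens : Type;
  ole : opens -> opens -> Prop;
  otop : opens;
  omeet : opens -> opens -> opens;
  ojoin : set opens -> opens;
  ole_refl : forall a, ole a a;
  ole_trans : forall b a c, ole a b -> ole b c -> ole a c;
  ole_anti : forall a b, ole a b -> ole b a -> a = b;
  ole_top : forall a, ole a otop;
  omeetP : forall a b c, ole c (omeet a b) <-> ole c a /\ ole c b;
  ojoinP : forall A c, ole (ojoin A) c <-> (forall a, A a -> ole a c);
  omeet_join : forall a A, omeet a (ojoin A) = ojoin (omeet a @` A)
}.

Arguments ole {l} _ _.
Arguments otop {l}.
Arguments omeet {l} _ _.
Arguments ojoin {l} _.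

Definition obot (X : locale) : opens X := ojoin set0.
Definition ojoin2 (X : locale) (a b : opens X) : opens X := ojoin [set a; b].

Arguments obot {X}.

(* A locale map X -> Y is a frame homomorphism in the opposite direction. *)
Record locale_map (X Y : locale) := LocaleMap {
  pullback : opens Y -> opens X;
  pullback_top : pullback otop = otop;
  pullback_meet : forall a b,
    pullback (omeet a b) = omeet (pullback a) (pullback b);
  pullback_join : forall A, pullback (ojoin A) = ojoin (pullback @` A)
}.

Section Composition.
Variables (X Y Z : locale) (g : locale_map Y Z) (f : locale_map X Y).

Let h := pullback f \o pullback g.

Fact comp_top : h otop = otop.
Proof. by rewrite /h /= !pullback_top. Qed.

Fact comp_meet a b : h (omeet a b) = omeet (h a) (h b).
Proof. by rewrite /h /= !pullback_meet. Qed.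

Fact comp_join A : h (ojoin A) = ojoin (h @` A).
Proof. by rewrite /h /= !pullback_join image_comp. Qed.

Definition locale_comp : locale_map X Z := LocaleMap comp_top comp_meet comp_join.
End Composition.

Lemma locale_map_eq (X Y : locale) (f g : locale_map X Y) :
  (forall b, pullback f b = pullback g b) -> f = g.
Proof.
case: f g => [f f1 f2 f3] [g g1 g2 g3] /= /funext fg; subst g.
by congr LocaleMap; apply: Prop_irrelevance.
Qed.

Definition surjection (X Y : locale) (f : locale_map X Y) : Prop :=
  injective (pullback f).

Definition right_adjoint (X Y : locale)
    (f : opens Y -> opens X) (g : opens X -> opens Y) : Prop :=
  forall a b, ole (f b) a <-> ole b (g a).

Definition directed (X : locale) (A : set (opens X)) : Prop :=
  (exists a, A a) /\
  (forall a b, A a -> A b -> exists c, [/\ A c, ole a c & ole b c]).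

Definition preserves_directed_joins (X Y : locale) (g : opens X -> opens Y) : Prop :=
  forall A, directed A -> g (ojoin A) = ojoin (g @` A).

Definition proper (X Y : locale) (f : locale_map X Y) : Prop :=
  exists g : opens X -> opens Y,
    [/\ right_adjoint (pullback f) g,
        preserves_directed_joins g &
        forall a b, g (ojoin2 a (pullback f b)) = ojoin2 (g a) b].

Definition preframe_hom (X Y : locale) (g : opens X -> opens Y) : Prop :=
  [/\ g otop = otop,
      forall a b, g (omeet a b) = omeet (g a) (g b) &
      preserves_directed_joins g].

(** * Locales presented by sites *)

(* The frame presented by a preordered base and a stable coverage is realised
   as the lattice of C-ideals: down-closed subsets U of the base such that
   a is in U as soon as a is covered by a subset of U. [gen_ideal A] is the C-ideal
   generated by A. *)
Inductive gen_ideal (B : Type) (le : B -> B -> Prop)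
    (cov : B -> set B -> Prop) (A : set B) : B -> Prop :=
| gen_in a : A a -> gen_ideal le cov A a
| gen_down a b : le a b -> gen_ideal le cov A b -> gen_ideal le cov A a
| gen_cov a V : cov a V -> (forall v, V v -> gen_ideal le cov A v) ->
    gen_ideal le cov A a.

Record site := Site {
  base : Type;
  ble : base -> base -> Prop;
  bcov : base -> set base -> Prop;
  ble_refl : forall a, ble a a;
  ble_trans : forall b a c, ble a b -> ble b c -> ble a c;
  bcov_stable : forall a b V, ble a b -> bcov b V ->
    gen_ideal ble bcov [set x | ble x a /\ exists2 v, V v & ble x v] a
}.

Definition gen (B : site) (A : set (base B)) : set (base B) :=
  gen_ideal (@ble B) (@bcov B) A.

Definition is_ideal (B : site) (U : set (base B)) : Prop :=
  (forall a b, ble a b -> U b -> U a) /\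
  (forall a V, bcov a V -> V `<=` U -> U a).

Record ideal (B : site) := Ideal {
  ideal_set :> base B -> Prop;
  ideal_setP : is_ideal ideal_set
}.

Lemma ideal_eq (B : site) (U V : ideal B) : (forall a, U a <-> V a) -> U = V.
Proof.
case: U V => [U pU] [V pV] /= UV.
have {}UV : U = V by apply/funext => a; apply/propext.
by subst V; congr Ideal; apply: Prop_irrelevance.
Qed.

Section Ideals.
Variable B : site.
Implicit Types (A : set (base B)) (U : ideal B).

Lemma gen_idealP A : is_ideal (gen A).
Proof.
split=> [a b ab|a V aV VA]; [exact: gen_down|exact: gen_cov aV VA].
Qed.

Definition genI A : ideal B := Ideal (gen_idealP A).

Lemma gen_sub A (W : set (base B)) : is_ideal W -> A `<=` W -> gen A `<=` W.
Proof.
move=> [Wd Wc] AW a; elim=> {a} [a /AW//|a b ab _|a V aV _ VW]; first exact: Wd.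
exact: Wc aV VW.
Qed.

Lemma gen_subI A U : A `<=` ideal_set U -> gen A `<=` ideal_set U.
Proof. apply: gen_sub; exact: ideal_setP. Qed.

Lemma gen_bind A A' : A `<=` gen A' -> gen A `<=` gen A'.
Proof. apply: gen_sub; exact: gen_idealP. Qed.

Lemma gen_mono A A' : A `<=` A' -> gen A `<=` gen A'.
Proof. by move=> AA'; apply: gen_bind => a /AA'; apply: gen_in. Qed.

Lemma ideal_down U a b : ble a b -> U b -> U a.
Proof. exact: (ideal_setP U).1. Qed.

Lemma ideal_cov U a V : bcov a V -> V `<=` ideal_set U -> U a.
Proof. exact: (ideal_setP U).2. Qed.

Lemma gen_meet A (W : set (base B)) b : (forall x y, ble x y -> W y -> W x) ->
  gen A b -> forall a, ble a b -> W a ->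
  gen [set x | W x /\ exists2 y, A y & ble x y] a.
Proof.
move=> Wd; elim=> {b} [b Ab|b b' bb' _ IH|b V bV _ IH] a ab Wa.
- by apply: gen_in; split=> //; exists b.
- exact: IH (ble_trans ab bb') Wa.
- apply: gen_bind (bcov_stable ab bV) => x [xa [v Vv xv]].
  exact: IH Vv x xv (Wd _ _ xa Wa).
Qed.

Lemma is_ideal_top : is_ideal ([set: base B]).
Proof. by []. Qed.

Lemma is_ideal_meet U V : is_ideal (ideal_set U `&` ideal_set V).
Proof.
split=> [a b ab [Ub Vb]|a W aW WUV]; split.
- exact: ideal_down ab Ub.
- exact: ideal_down ab Vb.
- by apply: ideal_cov aW _ => w /WUV[].
- by apply: ideal_cov aW _ => w /WUV[].
Qed.

Definition ideal_le (U V : ideal B) : Prop := ideal_set U `<=` ideal_set V.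
Definition ideal_top : ideal B := Ideal is_ideal_top.
Definition ideal_meet (U V : ideal B) : ideal B := Ideal (is_ideal_meet U V).
Definition ideal_join (F : set (ideal B)) : ideal B :=
  genI (\bigcup_(U in F) ideal_set U).

Fact ideal_le_anti U V : ideal_le U V -> ideal_le V U -> U = V.
Proof. by move=> UV VU; apply: ideal_eq => a; split; [exact: UV|exact: VU]. Qed.

Fact ideal_le_trans V U W : ideal_le U V -> ideal_le V W -> ideal_le U W.
Proof. exact: subset_trans. Qed.

Fact ideal_meetP U V W :
  ideal_le W (ideal_meet U V) <-> ideal_le W U /\ ideal_le W V.
Proof.
split=> [h|[h1 h2] a Wa]; last by split; [exact: h1|exact: h2].
by split=> a /h[].
Qed.

Fact ideal_joinP F W :
  ideal_le (ideal_join F) W <-> (forall U, F U -> ideal_le U W).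
Proof.
split=> [h U FU a Ua|h]; first by apply/h/gen_in; exists U.
by apply: gen_subI => a [U FU Ua]; apply: h FU a Ua.
Qed.

Fact ideal_meet_join U F :
  ideal_meet U (ideal_join F) = ideal_join (ideal_meet U @` F).
Proof.
apply: ideal_le_anti.
- move=> a [Ua Fa].
  apply: gen_mono (gen_meet (@ideal_down U) Fa (ble_refl a) Ua).
  move=> x [Ux [y [V FV Vy] xy]].
  exists (ideal_meet U V); first by exists V.
  by split=> //; apply: ideal_down xy Vy.
- apply/ideal_joinP => _ [V FV <-] a [Ua Va]; split=> //.
  by apply: gen_in; exists V.
Qed.

Definition site_locale : locale := Locale
  (fun U => @subset_refl _ (ideal_set U) : ideal_le U U) ideal_le_trans ideal_le_anti
  (fun U => @subsetT _ (ideal_set U) : ideal_le U ideal_top)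
  ideal_meetP ideal_joinP ideal_meet_join.

Definition basic (a : base B) : opens site_locale := genI [set a].

End Ideals.

(* A locale map between sites from a relation R, where [R a b] expresses that
   the basic open a is mapped into the basic open b. *)
Section SiteMap.
Variables (B B' : site) (R : base B -> base B' -> Prop).
Hypothesis Rdown : forall x a b, ble x a -> R a b -> R x b.
Hypothesis Rup : forall a b c, ble b c -> R a b -> R a c.
Hypothesis Rtop : forall a, gen [set x | exists b, R x b] a.
Hypothesis Rmeet : forall a b c, R a b -> R a c ->
  exists d, [/\ ble d b, ble d c & R a d].
Hypothesis Rcov : forall a b V, bcov b V -> R a b ->
  gen [set x | exists2 v, V v & R x v] a.

Definition site_pullback (U : opens (site_locale B')) : opens (site_locale B) :=
  genI [set a | exists2 b, (U : ideal B') b & R a b].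

Fact site_pullback_top : site_pullback otop = otop.
Proof.
apply: ideal_eq => a; split=> // _.
by apply: gen_mono (Rtop a) => x [b xb]; exists b.
Qed.

Fact site_pullback_meet U V :
  site_pullback (omeet U V) = omeet (site_pullback U) (site_pullback V).
Proof.
apply: ideal_eq => a; split.
- by move=> h; split; apply: gen_mono h => x [b [Ub Vb] xb]; exists b.
- move=> [aU aV].
  have := gen_meet (@ideal_down _ (genI _)) aV (ble_refl a) aU.
  apply: gen_bind => x [xU [y [c Vc yc] xy]].
  have xc := Rdown xy yc.
  pose W := [set x | R x c].
  have Wd z w : ble z w -> W w -> W z by move=> zw; apply: Rdown zw.
  have := gen_meet Wd xU (ble_refl x) xc.
  apply: gen_mono => z [zc [w [b Ub wb] zw]].
  have [d [db dc zd]] := Rmeet (Rdown zw wb) zc.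
  by exists d => //; split; [exact: ideal_down db Ub|exact: ideal_down dc Vc].
Qed.

Fact site_pullback_join F :
  site_pullback (ojoin F) = ojoin (site_pullback @` F).
Proof.
apply: (@ole_anti (site_locale B)); last first.
  apply/ojoinP => _ [U FU <-]; apply: gen_mono => x [b Ub xb].
  by exists b => //; apply: gen_in; exists U.
apply: gen_subI => a [b Fb ab].
elim: Fb a ab => {b} [b [U FU Ub]|b b' bb' _ IH|b V bV _ IH] a ab.
- apply: gen_in; exists (site_pullback U); first by exists U.
  by apply: gen_in; exists b.
- by apply: IH; apply: Rup bb' ab.
- by apply: gen_bind (Rcov bV ab) => x [v Vv xv]; apply: IH Vv x xv.
Qed.

Definition site_map : locale_map (site_locale B) (site_locale B') :=
  LocaleMap site_pullback_top site_pullback_meet site_pullback_join.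
End SiteMap.

(** * Cantor space *)

(* Signs are booleans, [false] for - and [true] for +; 2^* is [seq bool]. *)
Definition fseq := seq bool.

Definition cantor_le (s t : fseq) : Prop := prefix t s.

Inductive cantor_cov : fseq -> set fseq -> Prop :=
| cantor_cov_split s : cantor_cov s [set rcons s false; rcons s true].

Fact cantor_le_refl s : cantor_le s s.
Proof. exact: prefix_refl. Qed.

Fact cantor_le_trans t s u : cantor_le s t -> cantor_le t u -> cantor_le s u.
Proof. by move=> st tu; apply: prefix_trans tu st. Qed.

Lemma prefix_rconsP (s t : fseq) : prefix s t ->
  t = s \/ exists b, prefix (rcons s b) t.
Proof.
move=> /prefixP[[|b u] ->]; first by left; rewrite cats0.
by right; exists b; rewrite -cat_rcons prefix_prefix.
Qed.

Fact cantor_stable s t V : cantor_le s t -> cantor_cov t V ->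
  gen_ideal cantor_le cantor_cov
    [set x | cantor_le x s /\ exists2 v, V v & cantor_le x v] s.
Proof.
move=> st cV; case: cV st => {}t /prefix_rconsP[->|[b bs]].
  apply: gen_cov (cantor_cov_split t) _ => v Vv; apply: gen_in; split.
    by case: Vv => ->; apply: prefix_rcons.
  by exists v => //; apply: cantor_le_refl.
apply: gen_in; split; first exact: cantor_le_refl.
by exists (rcons t b) => //; case: (b); [right|left].
Qed.

Definition cantor_site : site :=
  Site cantor_le_refl cantor_le_trans cantor_stable.

Definition Cantor : locale := site_locale cantor_site.

Lemma cantor_ideal_split (U : ideal cantor_site) (s : fseq) :
  (forall b, U (rcons s b)) -> U s.
Proof.
move=> h; apply: (@ideal_cov _ U s _ (cantor_cov_split s)).
by move=> v [->|->]; apply: h.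
Qed.

(** * The interval [-1,1] *)

(* The base element (p, q) stands for the open {x | p < x < q}. The first two
   and the last clauses are the usual presentation of the Dedekind reals; the
   other two cut down to the closed sublocale -1 <= x <= 1. *)
Definition ivl_le (a b : rat * rat) : Prop := b.1 <= a.1 /\ a.2 <= b.2.

Inductive ivl_cov : rat * rat -> set (rat * rat) -> Prop :=
| ivl_cov_empty p q : q <= p -> ivl_cov (p, q) set0
| ivl_cov_split p q r s : p <= r -> r < s -> s <= q ->
    ivl_cov (p, q) [set (p, s); (r, q)]
| ivl_cov_below p q : q <= -1 -> ivl_cov (p, q) set0
| ivl_cov_above p q : 1 <= p -> ivl_cov (p, q) set0
| ivl_cov_inner p q : ivl_cov (p, q) [set a | p < a.1 /\ a.2 < q].

Fact ivl_le_refl a : ivl_le a a.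
Proof. by split. Qed.

Fact ivl_le_trans b a c : ivl_le a b -> ivl_le b c -> ivl_le a c.
Proof.
by move=> [h1 h2] [h3 h4]; split; [apply: le_trans h1|apply: le_trans h4].
Qed.

Fact ivl_stable a b V : ivl_le a b -> ivl_cov b V ->
  gen_ideal ivl_le ivl_cov [set x | ivl_le x a /\ exists2 v, V v & ivl_le x v] a.
Proof.
move=> ab bV; case: bV a ab => {b V} [p q qp|p q r s pr rs sq|p q q1|p q p1|p q]
  [x y] [/= px yq].
- by apply: gen_cov (ivl_cov_empty _) _ => //; lra.
- have [ys|sy] := leP y s.
    by apply: gen_in; split; [exact: ivl_le_refl|exists (p, s); [left|]].
  have [rx|xr] := leP r x.
    by apply: gen_in; split; [exact: ivl_le_refl|exists (r, q); [right|]].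
  apply: gen_cov (ivl_cov_split (ltW xr) rs (ltW sy)) _.
  move=> v [->|->]; apply: gen_in; split.
  + by split=> //=; apply: ltW.
  + by exists (p, s); [left|split].
  + by split=> //=; apply: ltW.
  + by exists (r, q); [right|split].
- by apply: gen_cov (ivl_cov_below _ _) _ => //; lra.
- by apply: gen_cov (ivl_cov_above _ _) _ => //; lra.
- apply: gen_cov (ivl_cov_inner x y) _ => -[x' y'] [/= xx' y'y].
  apply: gen_in; split; first by split=> /=; apply: ltW.
  by exists (x', y'); [split=> /=; lra|exact: ivl_le_refl].
Qed.

Definition ivl_site : site := Site ivl_le_refl ivl_le_trans ivl_stable.

Definition Interval : locale := site_locale ivl_site.

Definition ivl (p q : rat) : opens Interval := basic (B := ivl_site) (p, q).

(** * The map c *)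

Definition sgn (b : bool) : rat := if b then 1 else -1.

(* Prefixing a sign, as a map 2^omega -> 2^omega. *)
Definition cons_rel (b : bool) (s t : fseq) : Prop := prefix t (b :: s).

Section Cons.
Variable b : bool.
Let R : base cantor_site -> base cantor_site -> Prop := cons_rel b.

Fact cons_down x s t : ble x s -> R s t -> R x t.
Proof.
by move=> xs st; apply: prefix_trans st _; rewrite /= eqxx.
Qed.

Fact cons_up s t u : ble t u -> R s t -> R s u.
Proof. exact: prefix_trans. Qed.

Fact cons_top s : gen [set x | exists t, R x t] s.
Proof. by apply: gen_in; exists [::]; apply: prefix0s. Qed.

Fact cons_meet s t u : R s t -> R s u ->
  exists v, [/\ ble v t, ble v u & R s v].
Proof. by move=> st su; exists (b :: s); split=> //; apply: prefix_refl. Qed.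

Fact cons_cov s t V : bcov t V -> R s t -> gen [set x | exists2 v, V v & R x v] s.
Proof.
move=> tV; case: tV s => {}t s /prefix_rconsP[<-|[d ds]].
  apply: gen_cov (cantor_cov_split s) _ => v [->|->]; apply: gen_in.
    exists (b :: rcons s false); [by left|exact: prefix_refl].
  exists (b :: rcons s true); [by right|exact: prefix_refl].
by apply: gen_in; exists (rcons t d) => //; case: (d); [right|left].
Qed.

Definition cantor_cons : locale_map Cantor Cantor :=
  site_map cons_down cons_up cons_top cons_meet cons_cov.
End Cons.

(* x |-> (sgn b + x) / 2, as a map I -> I. *)
Definition half_rel (b : bool) (u v : rat * rat) : Prop :=
  v.1 <= (sgn b + u.1) / 2 /\ (sgn b + u.2) / 2 <= v.2.

Section Half.
Variable b : bool.
Let R : base ivl_site -> base ivl_site -> Prop := half_rel b.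

Fact half_down x u v : ble x u -> R u v -> R x v.
Proof. by rewrite /R /half_rel => -[/= h1 h2] [h3 h4]; split; lra. Qed.

Fact half_up u v w : ble v w -> R u v -> R u w.
Proof. by rewrite /R /half_rel => -[/= h1 h2] [h3 h4]; split; lra. Qed.

Fact half_top u : gen [set x | exists v, R x v] u.
Proof.
by apply: gen_in; exists ((sgn b + u.1) / 2, (sgn b + u.2) / 2); split=> /=.
Qed.

Fact half_meet u v w : R u v -> R u w -> exists z, [/\ ble z v, ble z w & R u z].
Proof.
move=> [h1 h2] [h3 h4].
by exists ((sgn b + u.1) / 2, (sgn b + u.2) / 2); split; split=> /=.
Qed.

Fact half_cov u v V : bcov v V -> R u v -> gen [set x | exists2 w, V w & R x w] u.
Proof.
have sb : -1 <= sgn b <= 1 by rewrite /sgn; case: b; lra.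
rewrite /R /half_rel; move: sb; set e := sgn b => sb.
move=> vV; case: vV u => {v V} [p q qp|p q r s pr rs sq|p q q1|p q p1|p q]
  [x y] /= [px yq].
- by apply: gen_cov (ivl_cov_empty _) _ => //; lra.
- have [ys|sy] := leP y (2 * s - e).
    by apply: gen_in; exists (p, s); [left|split=> /=; lra].
  have [rx|xr] := leP (2 * r - e) x.
    by apply: gen_in; exists (r, q); [right|split=> /=; lra].
  have rs' : 2 * r - e < 2 * s - e by lra.
  apply: gen_cov (ivl_cov_split (ltW xr) rs' (ltW sy)) _.
  move=> w [->|->]; apply: gen_in.
  + by exists (p, s); [left|split=> /=; lra].
  + by exists (r, q); [right|split=> /=; lra].
- by apply: gen_cov (ivl_cov_below _ _) _ => //; lra.
- by apply: gen_cov (ivl_cov_above _ _) _ => //; lra.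
- apply: gen_cov (ivl_cov_inner x y) _ => -[x' y'] [/= xx' y'y].
  apply: gen_in; exists ((e + x') / 2, (e + y') / 2); first by split=> /=; lra.
  by split.
Qed.

Definition ivl_half : locale_map Interval Interval :=
  site_map half_down half_up half_top half_meet half_cov.
End Half.

Definition is_c (c : locale_map Cantor Interval) : Prop :=
  forall b : bool, locale_comp c (cantor_cons b) = locale_comp (ivl_half b) c.

(* [cval x s] = c(s sigma) where x = c(sigma). As c(-^omega) = -1 and
   c(+^omega) = 1, c(s -^omega) = cval (-1) s and c(s +^omega) = cval 1 s;
   see [cmap_stream]. *)
Fixpoint cval (x : rat) (s : fseq) : rat :=
  if s is b :: s' then (sgn b + cval x s') / 2 else x.

Definition cmin (s : fseq) : rat := cval (-1) s.
Definition cmax (s : fseq) : rat := cval 1 s.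

Lemma cval_cat x s t : cval x (s ++ t) = cval (cval x t) s.
Proof. by elim: s => //= b s ->. Qed.

Lemma cval_mono x y s : x <= y -> cval x s <= cval y s.
Proof. by move=> xy; elim: s => //= b s IH; lra. Qed.

Lemma cval_bound x s : -1 <= x <= 1 -> -1 <= cval x s <= 1.
Proof. by move=> hx; elim: s => //= b s IH; rewrite /sgn; case: b; lra. Qed.

Lemma cmin_ge s : -1 <= cmin s.
Proof. by have /andP[] := @cval_bound (-1) s erefl. Qed.

Lemma cmax_le s : cmax s <= 1.
Proof. by have /andP[] := @cval_bound 1 s erefl. Qed.

Lemma cmin_le_cmax s : cmin s <= cmax s.
Proof. exact: cval_mono. Qed.

Lemma cmin_prefix s t : prefix s t -> cmin s <= cmin t.
Proof. by move=> /prefixP[u ->]; rewrite /cmin cval_cat cval_mono ?cmin_ge. Qed.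

Lemma cmax_prefix s t : prefix s t -> cmax t <= cmax s.
Proof. by move=> /prefixP[u ->]; rewrite /cmax cval_cat cval_mono ?cmax_le. Qed.

Lemma cwidth s : (cmax s - cmin s) * 2 ^+ size s = 2.
Proof.
rewrite /cmax /cmin; elim: s => [|b s IH] /=; first by rewrite expr0; lra.
by rewrite exprS -[RHS]IH; field.
Qed.

Lemma archi_pow (e : rat) : 0 < e -> exists n, 2 < e * 2 ^+ n.
Proof.
move=> e0; pose n := Num.Def.archi_bound (2 / e); exists n.
have h : 2 / e < n%:R.
  by apply: archi_boundP; rewrite divr_ge0// ltW.
have h2 : (n%:R : rat) <= 2 ^+ n.
  by rewrite -natrX ler_nat ltnW// ltn_expl.
by rewrite mulrC -ltr_pdivrMr//; apply: lt_le_trans h h2.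
Qed.

Lemma cwidth_small e : 0 < e -> exists n, forall u, (n <= size u)%N ->
  cmax u - cmin u < e.
Proof.
move=> e0; have [n hn] := archi_pow e0; exists n => u nu.
have := cwidth u.
have h : (2 : rat) ^+ n <= 2 ^+ size u by apply: ler_weXn2l.
have p : (0 : rat) < 2 ^+ size u by apply: exprn_gt0.
rewrite ltNge => eq; apply/negP => le.
have : e * 2 ^+ size u <= 2 by rewrite -[leRHS]eq ler_wpM2r// ltW.
have : e * 2 ^+ n <= e * 2 ^+ size u by rewrite ler_wpM2l// ltW.
lra.
Qed.

(* To prove that s belongs to an open of 2^omega, extend s until c(s sigma) is
   known up to e. *)
Lemma cantor_refine (U : ideal cantor_site) (e : rat) (s : fseq) : 0 < e ->
  (forall u : fseq, prefix s u -> cmax u - cmin u < e -> U u) -> U s.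
Proof.
move=> e0 hU; have [n hn] := cwidth_small e0.
suff H k (u : fseq) : prefix s u -> (n <= size u + k)%N -> U u.
  by apply: (H n); [exact: prefix_refl|exact: leq_addl].
elim: k u => [|k IH] u su; first by rewrite addn0 => /hn; apply: hU.
move=> nu; apply: cantor_ideal_split => b; apply: IH.
- exact: prefix_trans su (prefix_rcons _ _).
- by rewrite size_rcons addSnnS.
Qed.

(* Existence of c: the image of the cylinder of s is the closed interval
   [cmin s, cmax s]. *)
Definition c_rel (s : base cantor_site) (u : base ivl_site) : Prop :=
  u.1 < cmin s /\ cmax s < u.2.

Fact c_down x s u : ble x s -> c_rel s u -> c_rel x u.
Proof.
move=> sx [h1 h2]; split; first exact: lt_le_trans h1 (cmin_prefix sx).
exact: le_lt_trans (cmax_prefix sx) h2.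
Qed.

Fact c_up s u v : ble u v -> c_rel s u -> c_rel s v.
Proof.
by move=> [h1 h2] [h3 h4]; split; [apply: le_lt_trans h3|apply: lt_le_trans h2].
Qed.

Fact c_top s : gen [set x | exists u, c_rel x u] s.
Proof.
apply: gen_in; exists (-2, 2); split=> /=.
  by apply: lt_le_trans (cmin_ge s).
by apply: le_lt_trans (cmax_le s) _.
Qed.

Fact c_meet s u v : c_rel s u -> c_rel s v ->
  exists w, [/\ ble w u, ble w v & c_rel s w].
Proof.
move=> [h1 h2] [h3 h4].
exists (Num.max u.1 v.1, Num.min u.2 v.2); split.
- by split=> /=; rewrite ?le_max ?ge_min lexx.
- by split=> /=; rewrite ?le_max ?ge_min lexx orbT.
- by split=> /=; rewrite ?gt_max ?lt_min ?h1 ?h2.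
Qed.

Fact c_cov s u V : bcov u V -> c_rel s u -> gen [set x | exists2 v, V v & c_rel x v] s.
Proof.
have m1 := cmin_ge s; have m2 := cmax_le s; have m3 := cmin_le_cmax s.
move=> uV; case: uV => {u V} [p q qp|p q r t pr rt tq|p q q1|p q p1|p q] [/= h1 h2];
  try by exfalso; lra.
- have e0 : 0 < t - r by lra.
  apply: (cantor_refine (U := genI _) e0) => u su hu.
  have h3 := cmin_prefix su; have h4 := cmax_prefix su.
  apply: gen_in; have [tu|ut] := leP t (cmax u).
    by exists (r, q); [right|split=> /=; lra].
  by exists (p, t); [left|split=> /=; lra].
- apply: gen_in; exists ((p + cmin s) / 2, (cmax s + q) / 2);
    by split=> /=; lra.
Qed.

Definition c_impl : locale_map Cantor Interval :=
  site_map c_down c_up c_top c_meet c_cov.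

Lemma basic_sub (B : site) (U : ideal B) a : U a ->
  @ole (site_locale B) (basic a) U.
Proof. by move=> Ua; apply: gen_subI => _ ->. Qed.

Lemma basic_in (B : site) (a : base B) : (basic a : ideal B) a.
Proof. exact: gen_in. Qed.

Lemma pullback_mono (X Y : locale) (f : locale_map X Y) (a b : opens Y) :
  ole a b -> ole (pullback f a) (pullback f b).
Proof.
move=> ab; have -> : a = omeet a b.
  apply: ole_anti; first by apply/omeetP; split=> //; apply: ole_refl.
  by have /omeetP[] := ole_refl (omeet a b).
rewrite pullback_meet.
by have /omeetP[] := ole_refl (omeet (pullback f a) (pullback f b)).
Qed.

Lemma ideal_join_basic (B : site) (U : ideal B) :
  U = ojoin (l := site_locale B) (@basic B @` U).
Proof.
apply: ideal_eq => a; split=> [Ua|].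
  apply: gen_in; exists (basic a); last exact: basic_in.
  by exists a.
by apply: gen_subI => x [_ [y Uy <-]]; apply: basic_sub.
Qed.

Lemma cantor_consE b (U : opens Cantor) (s : fseq) :
  (pullback (cantor_cons b) U : ideal cantor_site) s <->
  (U : ideal cantor_site) (b :: s).
Proof.
split=> [|Us]; last by apply: gen_in; exists (b :: s) => //; apply: prefix_refl.
elim=> {s} [s [t Ut st]|s t st _ IH|s V sV _ IH].
- exact: (@ideal_down _ U _ _ st Ut).
- by apply: (@ideal_down _ U _ _ _ IH); rewrite /= /cantor_le /= eqxx.
- case: sV IH => {}s IH; apply: (@cantor_ideal_split U (b :: s)) => d.
  by apply: (IH (rcons s d)); case: d; [right|left].
Qed.

Lemma ivl_half_in b p q :
  (pullback (ivl_half b) (ivl p q) : ideal ivl_site) (2 * p - sgn b, 2 * q - sgn b).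
Proof.
by apply: gen_in; exists (p, q); [exact: basic_in|split=> /=; lra].
Qed.

Lemma ivl_full p q : p < -1 -> 1 < q -> ivl p q = otop.
Proof.
move=> p1 q1; apply: ideal_eq => -[x y]; split=> // _.
pose x' := Num.min x p; pose y' := Num.max y q.
have [hx hp] : x' <= x /\ x' <= p by rewrite /x' !ge_min !lexx orbT.
have [hy hq] : y <= y' /\ q <= y' by rewrite /y' !le_max !lexx orbT.
apply: (gen_down (b := (x', y'))); first by split.
have h : -1 <= y' by lra.
apply: gen_cov (ivl_cov_split hp p1 h) _ => v [->|->].
  by apply: gen_cov (ivl_cov_below _ (lexx _)) _.
have h' : p <= 1 by lra.
apply: gen_cov (ivl_cov_split h' q1 hq) _ => w [->|->]; first exact: gen_in.
by apply: gen_cov (ivl_cov_above _ (lexx _)) _.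
Qed.

Lemma c_impl_is_c : is_c c_impl.
Proof.
move=> b; apply: locale_map_eq => /= U; apply: ideal_eq => s.
set T := site_pullback c_rel (site_pullback _ U).
rewrite cantor_consE; split=> [bsU|].
- suff W : gen [set a | exists2 u, (U : ideal ivl_site) u & c_rel a u] `<=`
      [set t | forall s, prefix t (b :: s) -> (T : ideal cantor_site) s].
    exact: W bsU s (prefix_refl _).
  apply: gen_sub; first split.
  + by move=> x y xy Wy r xr; apply: Wy; apply: prefix_trans xr.
  + move=> x V xV; case: xV => {}x VW r /prefix_rconsP[xr|[d dr]].
      apply: cantor_ideal_split => d; apply: (VW (rcons x d)).
        by case: (d); [right|left].
      by rewrite -xr; apply: prefix_refl.
    by apply: (VW (rcons x d)) dr; case: (d); [right|left].
  + move=> t [[p q] Upq tpq] r /(c_down (s := t)) /(_ tpq) [/= h1 h2].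
    apply: gen_in; exists (2 * p - sgn b, 2 * q - sgn b).
      by apply: gen_in; exists (p, q) => //; split=> /=; lra.
    by rewrite /cmin /cmax /= in h1 h2; split; rewrite /= /cmin /cmax; lra.
- move/(@gen_subI _ _ (pullback (cantor_cons b) (pullback c_impl U))) => h.
  apply/cantor_consE; apply: h => {s}s [u + su].
  move=> uU; elim: uU s su => {u} [u [v Uv uv]|u v uv _ IH|u V uV _ IH] s su.
  + apply/cantor_consE; apply: gen_in; exists v => //.
    case: uv su => h1 h2 [h3 h4]; split; rewrite /cmin /cmax /=;
      by rewrite /cmin /cmax in h3 h4; lra.
  + by apply: IH; apply: c_up uv su.
  + by apply: gen_subI (c_cov uV su) => x [v Vv xv]; apply: IH Vv x xv.
Qed.

Lemma is_c_in f : is_c f -> forall (s : fseq) (p q : rat), c_rel s (p, q) ->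
  (pullback f (ivl p q) : ideal cantor_site) s.
Proof.
move=> cf; elim=> [|b s IH] p q [/= h1 h2].
  by rewrite ivl_full ?pullback_top.
rewrite /cmin /cmax /= in h1 h2.
apply/cantor_consE.
have -> : pullback (cantor_cons b) (pullback f (ivl p q)) =
    pullback f (pullback (ivl_half b) (ivl p q)).
  by have /(congr1 (fun g => pullback g (ivl p q))) := cf b.
apply: (pullback_mono f (basic_sub (ivl_half_in b p q))).
by apply: IH; split; rewrite /= /cmin /cmax; lra.
Qed.

Lemma is_c_sub f : is_c f -> forall V, ole (pullback c_impl V) (pullback f V).
Proof.
move=> cf V; apply: gen_subI => s [[p q] Vpq spq].
exact: (pullback_mono f (basic_sub Vpq)) (is_c_in cf spq).
Qed.

Lemma is_c_disjoint f : is_c f -> forall (s : fseq) p q p' q', c_rel s (p, q) ->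
  (pullback f (ivl p' q') : ideal cantor_site) s -> q <= p' \/ q' <= p ->
  forall U : ideal cantor_site, U s.
Proof.
move=> cf s p q p' q' spq sf h U.
have : (pullback f (omeet (ivl p q) (ivl p' q')) : ideal cantor_site) s.
  by rewrite pullback_meet; split=> //; apply: is_c_in spq.
have -> : omeet (ivl p q) (ivl p' q') = obot.
  apply: ideal_eq => x; split=> [[xp xp']|]; last first.
    by apply: gen_subI => ? [].
  have := gen_meet (@ideal_down _ (ivl p q)) xp' (ble_refl x) xp.
  have : gen [set: base ivl_site] x by apply: gen_in.
  move=> _; apply: gen_bind => y [yp [_ -> yp']].
  have := gen_meet (W := fun y => ble y ((p', q') : base ivl_site))
    (fun _ _ => @ble_trans _ _ _ _) yp (ble_refl y) yp'.
  apply: gen_bind => -[a b] [[/= h1 h2] [_ -> [/= h3 h4]]].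
  by apply: gen_cov (ivl_cov_empty _) _ => //; lra.
rewrite /obot pullback_join image_set0 => hs.
by apply: gen_subI hs => ? [].
Qed.

Theorem c_exists_unique : exists! c : locale_map Cantor Interval, is_c c.
Proof.
exists c_impl; split; first exact: c_impl_is_c.
move=> f cf; apply: locale_map_eq => V.
apply: ole_anti; first exact: is_c_sub.
have E : V = ojoin [set ivl u.1 u.2 | u in
    [set u | exists p q, [/\ (V : ideal ivl_site) (p, q), p < u.1 & u.2 < q]]].
  apply: ideal_eq => -[p q]; split=> [Vpq|].
    apply: gen_cov (ivl_cov_inner p q) _ => -[p' q'] [/= h1 h2].
    apply: gen_in; exists (ivl p' q'); last exact: basic_in.
    by exists (p', q') => //; exists p, q.
  apply: gen_subI => u [_ [[p' q'] [x [y [Vxy h1 h2]]] <-]].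
  by apply: basic_sub; apply: ideal_down Vxy; split; apply: ltW.
rewrite [X in ole (pullback f X)]E pullback_join.
apply/ojoinP => _ [_ [[p' q'] [p [q [Vpq /= h1 h2]]] <-] <-] s sf.
pose e := Num.min (p' - p) (q - q').
have e0 : 0 < e by rewrite lt_min; lra.
apply: (cantor_refine e0) => u su; rewrite lt_min => /andP[k1 k2].
have uf := @ideal_down cantor_site (pullback f (ivl p' q')) u s su sf.
have m1 := cmin_ge u; have m2 := cmax_le u.
have [h3|h3] := leP (cmin u) p.
  apply: (is_c_disjoint cf (p := -2) (q := p') _ uf); last by left.
  by split=> /=; lra.
have [h4|h4] := leP q (cmax u).
  apply: (is_c_disjoint cf (p := q') (q := 2) _ uf); last by right.
  by split=> /=; lra.
by apply: gen_in; exists (p, q).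
Qed.

Definition cmap : locale_map Cantor Interval := sval (cid c_exists_unique).

Lemma cmap_spec : is_c cmap.
Proof. by rewrite /cmap; case: cid => f []. Qed.

Lemma cmapE : cmap = c_impl.
Proof.
have [f [_ uf]] := c_exists_unique.
by rewrite -(uf _ cmap_spec) -(uf _ c_impl_is_c).
Qed.

(* The stream sigma belongs to the open U. *)
Definition stream_in (sigma : nat -> bool) (U : opens Cantor) : Prop :=
  exists n, (U : ideal cantor_site) (mkseq sigma n).

Lemma mkseq_nth b (t : fseq) n : (size t <= n)%N ->
  mkseq (nth b t) n = t ++ nseq (n - size t) b.
Proof.
move=> tn; apply: (@eq_from_nth _ b).
  by rewrite size_mkseq size_cat size_nseq subnKC.
move=> i; rewrite size_mkseq => i_n; rewrite nth_mkseq// nth_cat.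
case: ltnP => // ti; rewrite nth_nseq if_same nth_default//.
Qed.

Lemma mkseq_prefix (sigma : nat -> bool) m n : (m <= n)%N ->
  prefix (mkseq sigma m) (mkseq sigma n).
Proof.
move=> mn; apply/prefixP; exists (map sigma (iota m (n - m))).
by rewrite /mkseq -map_cat -{2}[m]add0n -iotaD subnKC.
Qed.

Lemma stream_in_gen sigma (A : set (base cantor_site)) :
  (forall x y, ble x y -> A y -> A x) ->
  stream_in sigma (genI A : opens Cantor) -> exists n, A (mkseq sigma n).
Proof.
move=> Ad [n]; move: {-2}(mkseq sigma n) (erefl (mkseq sigma n)) => x xn Ax.
have : ble (mkseq sigma n : base cantor_site) x by rewrite -xn; apply: prefix_refl.
elim: Ax n {xn} => {x} [x Ax|x y xy _ IH|x V xV _ IH] n nx.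
- by exists n; apply: Ad nx Ax.
- by apply: (IH n); apply: ble_trans nx xy.
- case: xV nx IH => {}x nx IH.
  have : ble (mkseq sigma n.+1 : base cantor_site) x.
    exact: prefix_trans nx (mkseq_prefix _ (leqnSn n)).
  move=> /prefix_rconsP[e|[d dn]].
    exfalso; have := size_prefix nx.
    by rewrite -e !size_mkseq ltnn.
  by apply: (IH (rcons x d) _ n.+1) => //; case: (d); [right|left].
Qed.

(* c(t -^omega) = cmin t and c(t +^omega) = cmax t. *)
Lemma cmap_stream (b : bool) (t : fseq) (p q : rat) :
  stream_in (nth b t) (pullback cmap (ivl p q)) <-> p < cval (sgn b) t < q.
Proof.
have cb k : cval (sgn b) (nseq k b) = sgn b.
  by elim: k => //= k ->; rewrite /sgn; case: (b); lra.
have ct n : (size t <= n)%N -> cval (sgn b) (mkseq (nth b t) n) = cval (sgn b) t.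
  by move=> tn; rewrite mkseq_nth// cval_cat cb.
have cle u : cmin u <= cval (sgn b) u <= cmax u.
  by rewrite /cmin /cmax !cval_mono// /sgn; case: (b).
rewrite cmapE; split=> [|/andP[h1 h2]].
- move/stream_in_gen => [|n [[x y] xy [/= h1 h2]]].
    by move=> x y xy [u uU yu]; exists u => //; apply: c_down xy yu.
  set v := cval (sgn b) t.
  have [vx vy] : x < v /\ v < y.
    have pm := mkseq_prefix (nth b t) (leq_maxl n (size t)).
    have := cle (mkseq (nth b t) (maxn n (size t))).
    rewrite ct ?leq_maxr// -/v.
    by have := cmin_prefix pm; have := cmax_prefix pm; lra.
  have v1 : -1 <= v <= 1 by apply: cval_bound; rewrite /sgn; case: (b).
  suff Z : gen [set ((p, q) : base ivl_site)] `<=`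
    [set u | u.1 < v -> v < u.2 -> p < v < q] by apply: Z xy vx vy.
  apply: gen_sub => [|_ -> /= -> ->//]; split.
    by move=> u w [/= k1 k2] h k3 k4; apply: h; lra.
  move=> u V uV; case: uV => {u V} [p' q' qp|p' q' r s pr rs sq|p' q' q1|p' q' p1|p' q']
    h /= k1 k2; try by exfalso; lra.
  + have [k3|k3] := ltP v s; first by apply: (h (p', s)) => //; left.
    by apply: (h (r, q')) => //=; [right|lra].
  + by apply: (h ((p' + v) / 2, (v + q') / 2)) => /=; [split=> /=|..]; lra.
- have e0 : 0 < Num.min (cval (sgn b) t - p) (q - cval (sgn b) t).
    by rewrite lt_min; lra.
  have [n hn] := cwidth_small e0.
  set m := maxn n (size t).
  have := hn (mkseq (nth b t) m); rewrite size_mkseq leq_maxl => /(_ isT).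
  have := cle (mkseq (nth b t) m); rewrite ct ?leq_maxr// lt_min.
  move=> /andP[k1 k2] /andP[k3 k4].
  exists m; apply: gen_in; exists (p, q); first exact: basic_in.
  by split=> /=; lra.
Qed.

(** * The preframe base S and theta *)

Definition up (s : fseq) : opens Cantor := basic (B := cantor_site) s.

Definition right_bristle (s r : fseq) : Prop :=
  exists2 t, r = rcons t true & prefix (rcons t false) s.

Definition left_bristle (s r : fseq) : Prop :=
  exists2 t, r = rcons t false & prefix (rcons t true) s.

Definition up_right (s : fseq) : opens Cantor :=
  ojoin2 (up s) (ojoin (up @` right_bristle s)).

Definition up_left (s : fseq) : opens Cantor :=
  ojoin2 (up s) (ojoin (up @` left_bristle s)).

(* S = S_left x S_right; [None] is the adjoined bottom. Only the underlying
   sets are needed, not the orders. *)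
Definition Sbase : Type := (option fseq * option fseq)%type.

Definition S_open (x : Sbase) : opens Cantor :=
  ojoin2 (oapp up_left obot x.1) (oapp up_right obot x.2).

Definition fseq_lt (s t : fseq) : Prop :=
  exists u, prefix (rcons u false) s /\ prefix (rcons u true) t.

Definition between (s t : fseq) : Prop :=
  [\/ fseq_lt t s, prefix t s, prefix s t |
      exists u k l, s = rcons u false ++ nseq k true /\
                    t = rcons u true ++ nseq l false].

(* The opens (x, 1] and [-1, x) of I. *)
Definition ivl_gt (x : rat) : opens Interval := ojoin (range (fun q => ivl x q)).
Definition ivl_lt (x : rat) : opens Interval := ojoin (range (fun p => ivl p x)).

Definition theta_right (t : option fseq) : opens Interval :=
  if t is Some t' then (if true \in t' then ivl_gt (cmin t') else otop) else obot.

Definition theta_left (s : option fseq) : opens Interval :=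
  if s is Some s' then (if false \in s' then ivl_lt (cmax s') else otop) else obot.

Definition theta (x : Sbase) : opens Interval :=
  let generic := ojoin2 (theta_left x.1) (theta_right x.2) in
  if x is (Some s, Some t) then (if `[< between s t >] then otop else generic)
  else generic.

(* Main.v *)
From mathcomp Require Import all_boot all_order all_algebra.
From mathcomp Require Import boolp classical_sets.
From mathcomp Require Import lra.
Require Import Defs.

Set Implicit Arguments.
Unset Strict Implicit.
Unset Printing Implicit Defensive.

Import Order.TTheory GRing.Theory Num.Theory.
Local Open Scope classical_set_scope.
Local Open Scope ring_scope.

(** The cylinder of a finite sequence [s] is mapped by c onto the dyadic cell
    [cmin s, cmax s]. Hence the right adjoint of c^* sends [U] to the family of
    those rational intervals (p, q) such that every cell strictly inside (p, q)
    belongs to [U], and the adjunction is immediate. Directed joins and the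
    Frobenius law are compactness arguments: the sequences below which finitely
    many data suffice form an open of Cantor space, so if this open contains all
    sufficiently small cells, it contains the empty sequence. Surjectivity is
    Frobenius at the bottom open, as every nonempty interval contains a cell.

    The lexicographic combinatorics of S becomes numerical: [up_right t] consists
    of the [u] with [cmin t <= cmin u], [up_left s] of those with
    [cmax u <= cmax s], and [between s t] means [cmin t <= cmax s]. For
    uniqueness, the complement of a cylinder is an open of S, so the union of the
    cylinders of length n contained in an open [U] is a finite meet of opens of S,
    and [U] is the directed join of these unions. *)

(** * Dyadic intervals *)

Lemma cmin_cons b s : cmin (b :: s) = (sgn b + cmin s) / 2.
Proof. by []. Qed.

Lemma cmax_cons b s : cmax (b :: s) = (sgn b + cmax s) / 2.
Proof. by []. Qed.

Lemma cmin_lt_cmax s : cmin s < cmax s.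
Proof. by rewrite /cmin /cmax; elim: s => //= b s IH; lra. Qed.

Lemma cmin_rcons s b :
  cmin (rcons s b) = if b then (cmin s + cmax s) / 2 else cmin s.
Proof.
elim: s => [|d s IH]; first by case: b; rewrite /cmin /cmax /= /sgn; lra.
by rewrite rcons_cons !cmin_cons cmax_cons IH; case: b {IH}; lra.
Qed.

Lemma cmax_rcons s b :
  cmax (rcons s b) = if b then cmax s else (cmin s + cmax s) / 2.
Proof.
elim: s => [|d s IH]; first by case: b; rewrite /cmin /cmax /= /sgn; lra.
by rewrite rcons_cons !cmax_cons cmin_cons IH; case: b {IH}; lra.
Qed.

(** At the first sign where the sequences differ, their cells fall on opposite sides of the midpoint
    of the common cell. *)
Lemma prefix_or_apart (s t : fseq) : (size s <= size t)%N ->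
  [\/ prefix s t, cmax s <= cmin t | cmax t <= cmin s].
Proof.
elim: s t => [|b s IH] [|d t] //=; [by constructor 1|by constructor 1|].
move=> /IH {}IH; rewrite !cmin_cons !cmax_cons.
have := (cmin_ge s, cmax_le s, (cmin_ge t, cmax_le t)).
case=> -[s1 s2] [t1 t2].
case: b; case: d; rewrite /= /sgn.
- by case: IH => h; [constructor 1|constructor 2; lra|constructor 3; lra].
- by constructor 3; lra.
- by constructor 2; lra.
- by case: IH => h; [constructor 1|constructor 2; lra|constructor 3; lra].
Qed.

Lemma cell_of (x : rat) n : -1 <= x <= 1 ->
  exists s, [/\ size s = n, cmin s <= x & x <= cmax s].
Proof.
elim: n x => [|n IH] x x1; first by exists [::]; split=> //; case/andP: x1.
have [x0|x0] := leP 0 x.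
  have [|s [sn s1 s2]] := IH (2 * x - 1); first lra.
  by exists (true :: s); rewrite cmin_cons cmax_cons /= sn /sgn; split=> //; lra.
have [|s [sn s1 s2]] := IH (2 * x + 1); first lra.
by exists (false :: s); rewrite cmin_cons cmax_cons /= sn /sgn; split=> //; lra.
Qed.

Lemma small_cell_of (x e : rat) n : -1 <= x <= 1 -> 0 < e ->
  exists s, [/\ (n <= size s)%N, cmin s <= x, x <= cmax s & cmax s - cmin s < e].
Proof.
move=> x1 e0; have [m hm] := cwidth_small e0.
have [s [sn s1 s2]] := cell_of (maxn n m) x1.
by exists s; split=> //; [rewrite sn leq_maxl|apply: hm; rewrite sn leq_maxr].
Qed.

(** A denominator-free stand-in for dyadic grid points: later arguments only need that deep cells
    are not cut by [x]. *)
Definition on_grid (n : nat) (x : rat) : Prop :=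
  forall w : fseq, (n <= size w)%N -> x <= cmin w \/ cmax w <= x.

Lemma on_grid_cmin s : on_grid (size s) (cmin s).
Proof.
move=> w /prefix_or_apart[sw|sw|sw]; last by right.
  by left; apply: cmin_prefix.
by left; apply: le_trans sw; apply: cmin_le_cmax.
Qed.

Lemma on_grid_cmax s : on_grid (size s) (cmax s).
Proof.
move=> w /prefix_or_apart[sw|sw|sw]; [by right; apply: cmax_prefix|by left|].
by right; apply: le_trans sw _; apply: cmin_le_cmax.
Qed.

Lemma on_gridW m n x : (m <= n)%N -> on_grid m x -> on_grid n x.
Proof. by move=> mn gx w nw; apply: gx; apply: leq_trans nw. Qed.

(** Induction along the uniform bar at depth [n]: the analogue of [cantor_refine] with depth in
    place of width. *)
Lemma cantor_ideal_long (U : ideal cantor_site) n (s : fseq) :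
  (forall w : fseq, prefix s w -> (n <= size w)%N -> U w) -> U s.
Proof.
move=> hU; suff H k (u : fseq) : prefix s u -> (n <= size u + k)%N -> U u.
  by apply: (H n); [exact: prefix_refl|exact: leq_addl].
elim: k u => [|k IH] u su; first by rewrite addn0; apply: hU.
move=> nu; apply: cantor_ideal_split => b; apply: IH.
- exact: prefix_trans su (prefix_rcons _ _).
- by rewrite size_rcons addSnnS.
Qed.

Lemma is_ideal_cantor (U : set fseq) :
  (forall s t, prefix t s -> U t -> U s) ->
  (forall s, (forall b, U (rcons s b)) -> U s) ->
  is_ideal (B := cantor_site) U.
Proof.
move=> Ud Us; split=> [s t|s V sV]; first exact: Ud.
by case: sV => {}s VU; apply: Us => b; apply: VU; case: b; [right|left].
Qed.

(** The gluing step of the compactness arguments, from both children to [s]. The only extension of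
    [s] not below a child is [s] itself; it is split, and [P] passes to the children. *)
Lemma ideal_below (U : ideal cantor_site) (P : fseq -> Prop) (s : fseq) :
  (forall u v, prefix u v -> P u -> P v) ->
  (forall b u, prefix (rcons s b) u -> P u -> U u) ->
  forall u, prefix s u -> P u -> U u.
Proof.
move=> Pd h u /prefix_rconsP[->|[b bu]] Pu; last exact: h bu Pu.
apply: cantor_ideal_split => b; apply: (h b); first exact: prefix_refl.
exact: Pd (prefix_rcons _ _) Pu.
Qed.

(** * The right adjoint of c^* *)

Definition inside (s : fseq) (u : rat * rat) : Prop := u.1 < cmin s /\ cmax s < u.2.

Lemma inside_prefix u s t : prefix s t -> inside s u -> inside t u.
Proof. exact: (@c_down t s u). Qed.

Lemma forall_c_ideal (U : opens Cantor) : is_ideal (B := ivl_site)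
  [set u | forall s : fseq, inside s u -> (U : ideal cantor_site) s].
Proof.
split=> [u v uv Vu s su|u V uV VU s su]; first exact: Vu (c_up uv su).
by apply: gen_subI (c_cov uV su) => x [v Vv xv]; apply: VU Vv _ xv.
Qed.

Definition forall_c (U : opens Cantor) : opens Interval := Ideal (forall_c_ideal U).

Lemma forall_c_adjoint : right_adjoint (pullback cmap) forall_c.
Proof.
rewrite cmapE => U V; split=> [h u Vu s su|h]; first by apply: h; apply: gen_in; exists u.
by apply: gen_subI => s [u Vu su]; apply: h Vu s su.
Qed.

Lemma forall_c_mono U V : ole U V -> ole (forall_c U) (forall_c V).
Proof. by move=> UV u Uu s /Uu; apply: UV. Qed.

Lemma ole_ojoin (X : locale) (A : set (opens X)) a : A a -> ole a (ojoin A).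
Proof. by move=> Aa; have /ojoinP := ole_refl (ojoin A); apply. Qed.

Lemma ojoin2P (X : locale) (a b c : opens X) :
  ole (ojoin2 a b) c <-> ole a c /\ ole b c.
Proof.
rewrite /ojoin2 ojoinP; split=> [h|[ha hb] _ [->|->]//].
by split; apply: h; [left|right].
Qed.

Lemma ole_ojoin2l (X : locale) (a b : opens X) : ole a (ojoin2 a b).
Proof. by apply: ole_ojoin; left. Qed.

Lemma ole_ojoin2r (X : locale) (a b : opens X) : ole b (ojoin2 a b).
Proof. by apply: ole_ojoin; right. Qed.

(** * Compactness: the Frobenius law and directed joins *)

Lemma ivl_ideal_chain (W : ideal ivl_site) (p q r s : rat) :
  W (p, s) -> W (r, q) -> r < s -> W (p, q).
Proof.
move=> Wps Wrq rs.
have [pr|rp] := leP p r; last by apply: (@ideal_down ivl_site W) Wrq; split=> //=; apply: ltW.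
have [sq|qs] := leP s q; last by apply: (@ideal_down ivl_site W) Wps; split=> //=; apply: ltW.
by apply: (@ideal_cov ivl_site W) (ivl_cov_split pr rs sq) _ => _ [->|->].
Qed.

(* The family of all pairs in [W] around a cell is already an ideal: this is
   the compactness of closed cells. *)
Lemma pullback_cmapE (W : opens Interval) (s : fseq) :
  (pullback cmap W : ideal cantor_site) s <->
  exists2 u, (W : ideal ivl_site) u & inside s u.
Proof.
rewrite cmapE; split=> [|[u Wu su]]; last by apply: gen_in; exists u.
pose A := [set s : fseq | exists2 u, (W : ideal ivl_site) u & inside s u].
suff iA : is_ideal (B := cantor_site) A by move: s; apply: (gen_sub iA).
apply: is_ideal_cantor => [x y xy [u Wu yu]|x h].
  by exists u => //; apply: inside_prefix yu.
have [[p s'] W1 [/= h1 h2]] := h false.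
have [[r q] W2 [/= h3 h4]] := h true.
rewrite cmin_rcons in h1; rewrite cmax_rcons in h2.
rewrite cmin_rcons in h3; rewrite cmax_rcons in h4.
exists (p, q); last by split.
by apply: ivl_ideal_chain W1 W2 _; lra.
Qed.

Lemma ivl_ideal_inner (W : ideal ivl_site) (p q : rat) :
  (forall a b, p < a -> a < b -> b < q -> W (a, b)) -> W (p, q).
Proof.
move=> h; apply: (@ideal_cov ivl_site W) (ivl_cov_inner p q) _ => -[a b] [/= pa bq].
have [ab|ba] := ltP a b; first exact: h.
exact: (@ideal_cov ivl_site W) (ivl_cov_empty ba) _.
Qed.

(** The length bound grows by the factor 3/2 at each step: an interval is the union of its left and
    right two thirds, which overlap in the middle third. *)
Lemma ivl_ideal_lebesgue (W : ideal ivl_site) (a b e : rat) : 0 < e ->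
  (forall x y, a <= x -> y <= b -> y - x < e -> W (x, y)) -> W (a, b).
Proof.
move=> e0 h.
have [n hn] : exists n, b - a < e * (3 / 2) ^+ n.
  (* As n/2 <= (3/2)^n, it suffices that e * n/2 exceeds |b - a|. *)
  pose n := Num.Def.archi_bound (2 * `|b - a| / e); exists n.
  have h1 : 2 * `|b - a| / e < n%:R.
    by apply: archi_boundP; rewrite divr_ge0 ?mulr_ge0// ltW.
  have h2 : (n%:R : rat) / 2 <= (3 / 2) ^+ n.
    elim: (n) => [|m IH]; first by rewrite expr0; lra.
    have h3 : (1 : rat) <= (3 / 2) ^+ m by apply: exprn_ege1; lra.
    by rewrite exprS -natr1; lra.
  rewrite ltr_pdivrMr// in h1.
  have h3 : e * (n%:R / 2) <= e * (3 / 2) ^+ n by apply: ler_wpM2l => //; apply: ltW.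
  apply: le_lt_trans (ler_norm _) (lt_le_trans _ h3).
  by rewrite mulrA ltr_pdivlMr// mulrC [e * _]mulrC.
suff H x y : a <= x -> y <= b -> y - x < e * (3 / 2) ^+ n -> W (x, y) by apply: H.
elim: n {hn} x y => [|n IH] x y ax yb; first by rewrite expr0 mulr1; apply: h.
rewrite exprS => hxy.
have [xy|yx] := ltP x y; last exact: (@ideal_cov ivl_site W) (ivl_cov_empty yx) _.
apply: (@ivl_ideal_chain W x y (x + (y - x) / 3) (x + (y - x) * 2 / 3)).
- by apply: IH; lra.
- by apply: IH; lra.
- by lra.
Qed.

Section Frobenius.
Variables (U : opens Cantor) (V : opens Interval).

(* Below [s], every short interval in [a, b] lies in [V] or in [forall_c U]. *)
Let good (a b : rat) (s : fseq) : Prop := exists2 e, 0 < e &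
  forall x y, a <= x -> y <= b -> y - x < e -> (V : ideal ivl_site) (x, y) \/
    (forall u : fseq, prefix s u -> inside u (x, y) -> (U : ideal cantor_site) u).

(** The alternative is chosen for each short interval separately: if either child yields [V], so
    does [s]; otherwise the two statements about [U] glue. *)
Lemma good_ideal a b : is_ideal (B := cantor_site) (good a b).
Proof.
apply: is_ideal_cantor => [s t ts [e e0 h]|s h].
  exists e => // x y ax yb xy; have [?|hU] := h x y ax yb xy; [by left|right].
  by move=> u su; apply: hU; apply: prefix_trans su.
have [e e0 he] := h false; have [f f0 hf] := h true.
exists (Num.min e f) => [|x y ax yb]; first by rewrite lt_min e0.
rewrite lt_min => /andP[/(he _ _ ax yb)[?|hU0] /(hf _ _ ax yb)[?|hU1]];
  try by left.
right; apply: ideal_below => [u v|]; first exact: inside_prefix.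
by case.
Qed.

Lemma forall_c_frobenius :
  forall_c (ojoin2 U (pullback cmap V)) = ojoin2 (forall_c U) V.
Proof.
apply: ole_anti; last first.
  apply/ojoin2P; split; first exact: forall_c_mono (ole_ojoin2l _ _).
  exact/forall_c_adjoint/ole_ojoin2r.
move=> [p q] hpq; apply: ivl_ideal_inner => a b pa ab bq.
have : good a b [::].
  (* A cell of width below [d] that is not inside (p, q) misses (a, b), so for it the second
     alternative of [good] is vacuous. *)
  pose d := Num.min (a - p) (q - b).
  have d0 : 0 < d by rewrite lt_min !subr_gt0 pa.
  apply: (cantor_refine (U := Ideal (good_ideal a b)) d0) => u _.
  rewrite lt_min => /andP[d1 d2].
  have [pu|up] := leP (cmin u) p.
    exists 1 => // x y ax yb _; right=> v uv [/= h1 h2]; exfalso.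
    by have := cmin_lt_cmax v; have := cmax_prefix uv; lra.
  have [uq|qu] := leP q (cmax u).
    exists 1 => // x y ax yb _; right=> v uv [/= h1 h2]; exfalso.
    by have := cmin_lt_cmax v; have := cmin_prefix uv; lra.
  apply: (gen_subI (U := Ideal (good_ideal a b))) (hpq u (conj up qu)).
  move=> {d0 d1 d2 up qu}u [_ [->|->]] uU.
    exists 1 => // x y _ _ _; right=> v uv _.
    exact: (@ideal_down cantor_site U v u uv uU).
  have [[r s] Vrs [/= ru us]] := (pullback_cmapE V u).1 uU.
  (* The bound is the margin of the cell in (r, s): a shorter interval either misses the cell, hence
     contains no subcell, or lies in (r, s). *)
  exists (Num.min (cmin u - r) (s - cmax u)) => [|x y ax yb].
    by rewrite lt_min !subr_gt0 ru.
  rewrite lt_min => /andP[h1 h2].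
  have [ux|xu] := leP (cmax u) x.
    right=> v uv [/= h3 h4]; exfalso.
    by have := cmin_lt_cmax v; have := cmax_prefix uv; lra.
  have [yu|uy] := leP y (cmin u).
    right=> v uv [/= h3 h4]; exfalso.
    by have := cmin_lt_cmax v; have := cmin_prefix uv; lra.
  by left; apply: (@ideal_down _ V _ _ _ Vrs); split=> /=; lra.
(* At the empty sequence the second alternative of [good] is membership in [forall_c U]. *)
case=> e e0 he; apply: (ivl_ideal_lebesgue e0) => x y ax yb xy.
have [Vxy|Uxy] := he x y ax yb xy; first exact: (ole_ojoin2r (X := Interval)).
apply: (@ole_ojoin2l Interval (forall_c U) V) => u.
by apply: Uxy; apply: prefix0s.
Qed.
End Frobenius.

Lemma forall_c_directed : preserves_directed_joins forall_c.
Proof.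
move=> A [[U0 AU0] dA]; apply: ole_anti; last first.
  by apply/ojoinP => _ [U AU <-]; apply: forall_c_mono (ole_ojoin AU).
move=> [p q] hpq; apply: ivl_ideal_inner => a b pa ab bq.
(* A single member of [A] has to serve all cells below [s]; directedness bounds the members found at
   the two children. *)
pose good := [set s : fseq | exists2 U, A U & forall u : fseq,
  prefix s u -> inside u (a, b) -> (U : ideal cantor_site) u].
have iG : is_ideal (B := cantor_site) good.
  apply: is_ideal_cantor => [s t ts [U AU h]|s h].
    by exists U => // u su; apply: h; apply: prefix_trans su.
  have [U AU hU] := h false; have [V AV hV] := h true.
  have [W [AW UW VW]] := dA _ _ AU AV; exists W => //.
  apply: ideal_below => [u v|]; first exact: inside_prefix.
  by case=> u su ui; [apply: VW; apply: hV|apply: UW; apply: hU].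
have : good [::].
  pose d := Num.min (a - p) (q - b).
  have d0 : 0 < d by rewrite lt_min !subr_gt0 pa.
  apply: (cantor_refine (U := Ideal iG) d0) => u _.
  rewrite lt_min => /andP[d1 d2].
  have [pu|up] := leP (cmin u) p.
    exists U0 => // v uv [/= h1 h2]; exfalso.
    by have := cmin_lt_cmax v; have := cmax_prefix uv; lra.
  have [uq|qu] := leP q (cmax u).
    exists U0 => // v uv [/= h1 h2]; exfalso.
    by have := cmin_lt_cmax v; have := cmin_prefix uv; lra.
  apply: (gen_subI (U := Ideal iG)) (hpq u (conj up qu)).
  move=> {d0 d1 d2 up qu}u [U AU uU]; exists U => // v uv _.
  exact: (@ideal_down cantor_site U v u uv uU).
case=> U AU hU; apply: gen_in; exists (forall_c U); first by exists U.
by move=> u; apply: hU; apply: prefix0s.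
Qed.

Lemma forall_c_preframe : preframe_hom forall_c.
Proof.
split; last exact: forall_c_directed.
- by apply: ideal_eq => u.
- move=> U V; apply: ideal_eq => u; split=> [h|[hU hV] s su].
    by split=> s /h[].
  by split; [apply: hU|apply: hV].
Qed.

(** * Surjectivity and properness of c *)

Lemma cantor_obot (s : fseq) : ~ (@obot Cantor : ideal cantor_site) s.
Proof.
have i0 : is_ideal (B := cantor_site) set0.
  by apply: is_ideal_cantor => // t /(_ true).
by apply: (gen_sub i0) => t [].
Qed.

Lemma forall_c_obot : forall_c obot = obot.
Proof.
apply: ole_anti; last by apply/ojoinP.
move=> [p q] h.
have [qp|pq] := leP q p; first exact: gen_cov (ivl_cov_empty qp) _.
have [q1|q1] := leP q (-1); first exact: gen_cov (ivl_cov_below p q1) _.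
have [p1|p1] := leP 1 p; first exact: gen_cov (ivl_cov_above q p1) _.
(* Clipped to [-1, 1], the interval is still nonempty; a cell around its midpoint narrower than half
   its length lies strictly inside. *)
exfalso; pose l := Num.max p (-1); pose r := Num.min q 1.
have lr : l < r by rewrite lt_min !gt_max pq q1 p1.
have [lp l1] : p <= l /\ -1 <= l by rewrite /l !le_max !lexx orbT.
have [rq r1] : r <= q /\ r <= 1 by rewrite /r !ge_min !lexx orbT.
have [||s [_ s1 s2 s3]] := @small_cell_of ((l + r) / 2) ((r - l) / 2) 0; [lra..|].
by apply: (@cantor_obot s); apply: h; split=> /=; lra.
Qed.

Lemma ojoin2_obotl (X : locale) (a : opens X) : ojoin2 obot a = a.
Proof.
apply: ole_anti; last exact: ole_ojoin2r.
by apply/ojoin2P; split; [apply/ojoinP|exact: ole_refl].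
Qed.

Lemma cmap_surjection : surjection cmap.
Proof.
apply: (can_inj (g := forall_c)) => V.
by have := forall_c_frobenius obot V; rewrite !ojoin2_obotl forall_c_obot ojoin2_obotl.
Qed.

Lemma cmap_proper : proper cmap.
Proof.
exists forall_c; split; [exact: forall_c_adjoint|exact: forall_c_directed|].
exact: forall_c_frobenius.
Qed.

(** * The opens of the preframe base *)

Lemma up_in (s t : fseq) : prefix s t -> (up s : ideal cantor_site) t.
Proof.
by move=> st; apply: (@ideal_down cantor_site (up s) t s st); apply: gen_in.
Qed.

(* Streams that end in minuses are ordered lexicographically as their values
   under c, so that [up_right t], the set of streams above [t -^omega],
   consists of the cells [u] with c(t -^omega) <= c(u -^omega). *)
Lemma up_rightE (t u : fseq) :
  (up_right t : ideal cantor_site) u <-> cmin t <= cmin u.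
Proof.
split=> [|tu].
  have iA : is_ideal (B := cantor_site) [set u | cmin t <= cmin u].
    apply: is_ideal_cantor => [x y yx /= h|x /(_ false)].
      exact: le_trans h (cmin_prefix yx).
    by rewrite /= cmin_rcons.
  move: u; suff : ole (up_right t) (Ideal iA : opens Cantor) by [].
  apply/ojoin2P; split; first by apply: basic_sub => /=.
  apply/ojoinP => _ [_ [v -> vt] <-]; apply: basic_sub => /=.
  have := cmax_prefix vt; have := cmin_lt_cmax t.
  by rewrite cmax_rcons cmin_rcons; lra.
(* A short [u] may lie in the join only after splitting; at depth [size t] a sequence either extends
   [t] or departs from it. *)
apply: (@cantor_ideal_long (up_right t) (size t)) => w uw tw.
have {uw}tu : cmin t <= cmin w := le_trans tu (cmin_prefix uw).
have [tw'|nprefix] := boolP (prefix t w).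
  exact: (@ole_ojoin2l Cantor (up t)) (up_in tw').
apply: (@ole_ojoin2r Cantor (up t)).
(* The bristle leaves [t] at the first sign where [w] differs; since [cmin w] is not smaller, [t]
   has - and [w] has + there. *)
have [v tv vw] : exists2 v, right_bristle t v & prefix v w.
  elim: t w tw tu nprefix => [|b t IH] [|d w] //=.
  rewrite ltnS !cmin_cons => tw tu nprefix.
  have := (cmin_ge t, cmax_le t, (cmin_ge w, cmax_le w)).
  case=> -[t1 t2] [w1 w2]; have wlt := cmin_lt_cmax w.
  case: b tu nprefix; case: d; rewrite /sgn /= => tu nprefix.
  - have [||_ [v -> tv] vw] // := IH w tw; first lra.
    by exists (true :: rcons v true) => //; exists (true :: v).
  - lra.
  - exists [:: true] => //=; last by rewrite prefix0s.
    by exists [::] => //=; rewrite prefix0s.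
  - have [||_ [v -> tv] vw] // := IH w tw; first lra.
    by exists (false :: rcons v true) => //; exists (false :: v).
by apply: (@ole_ojoin Cantor) (up_in vw); exists v.
Qed.

Lemma up_leftE (s u : fseq) :
  (up_left s : ideal cantor_site) u <-> cmax u <= cmax s.
Proof.
split=> [|tu].
  have iA : is_ideal (B := cantor_site) [set u | cmax u <= cmax s].
    apply: is_ideal_cantor => [x y yx /= h|x /(_ true)].
      exact: le_trans (cmax_prefix yx) h.
    by rewrite /= cmax_rcons.
  move: u; suff : ole (up_left s) (Ideal iA : opens Cantor) by [].
  apply/ojoin2P; split; first by apply: basic_sub => /=.
  apply/ojoinP => _ [_ [v -> vt] <-]; apply: basic_sub => /=.
  have := cmin_prefix vt; have := cmin_lt_cmax s.
  by rewrite cmax_rcons cmin_rcons; lra.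
apply: (@cantor_ideal_long (up_left s) (size s)) => w uw tw.
have {uw}tu : cmax w <= cmax s := le_trans (cmax_prefix uw) tu.
have [tw'|nprefix] := boolP (prefix s w).
  exact: (@ole_ojoin2l Cantor (up s)) (up_in tw').
apply: (@ole_ojoin2r Cantor (up s)).
have [v tv vw] : exists2 v, left_bristle s v & prefix v w.
  elim: s w tw tu nprefix => [|b s IH] [|d w] //=.
  rewrite ltnS !cmax_cons => tw tu nprefix.
  have := (cmin_ge s, cmax_le s, (cmin_ge w, cmax_le w)).
  case=> -[t1 t2] [w1 w2]; have wlt := cmin_lt_cmax w.
  case: b tu nprefix; case: d; rewrite /sgn /= => tu nprefix.
  - have [||_ [v -> tv] vw] // := IH w tw; first lra.
    by exists (true :: rcons v false) => //; exists (true :: v).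
  - exists [:: false] => //=; last by rewrite prefix0s.
    by exists [::] => //=; rewrite prefix0s.
  - lra.
  - have [||_ [v -> tv] vw] // := IH w tw; first lra.
    by exists (false :: rcons v false) => //; exists (false :: v).
by apply: (@ole_ojoin Cantor) (up_in vw); exists v.
Qed.

(* The end points of [S_open x]; the values chosen at bottom make the
   corresponding half empty. *)
Definition lend (s : option fseq) : rat := oapp cmax (-1) s.
Definition rend (t : option fseq) : rat := oapp cmin 1 t.

Definition Slevel (x : Sbase) : nat := maxn (oapp size 0%N x.1) (oapp size 0%N x.2).

Lemma lend_grid x : on_grid (Slevel x) (lend x.1).
Proof.
apply: on_gridW (leq_maxl _ _) _; case: x.1 => [s|] /=; first exact: on_grid_cmax.
by move=> w _; left; apply: cmin_ge.
Qed.

Lemma rend_grid x : on_grid (Slevel x) (rend x.2).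
Proof.
apply: on_gridW (leq_maxr _ _) _; case: x.2 => [s|] /=; first exact: on_grid_cmin.
by move=> w _; right; apply: cmax_le.
Qed.

Lemma lend_bound s : -1 <= lend s <= 1.
Proof.
case: s => [s|] /=; last lra.
by rewrite cmax_le andbT; apply: le_trans (cmin_ge s) (cmin_le_cmax s).
Qed.

Lemma rend_bound t : -1 <= rend t <= 1.
Proof.
case: t => [t|] /=; last lra.
by rewrite cmin_ge /=; apply: le_trans (cmin_le_cmax t) (cmax_le t).
Qed.

Lemma left_halfE s (u : fseq) :
  (oapp up_left obot s : ideal cantor_site) u <-> cmax u <= lend s.
Proof.
case: s => [s|] /=; first exact: up_leftE.
split=> [/cantor_obot//|].
by have := cmin_ge u; have := cmin_lt_cmax u; lra.
Qed.

Lemma right_halfE t (u : fseq) :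
  (oapp up_right obot t : ideal cantor_site) u <-> rend t <= cmin u.
Proof.
case: t => [t|] /=; first exact: up_rightE.
split=> [/cantor_obot//|].
by have := cmax_le u; have := cmin_lt_cmax u; lra.
Qed.

(** A join of opens is not a union of sets of sequences, as splitting can add short ones. From depth
    [Slevel x] on, no cell is cut by an end point, and the union is already closed under
    splitting. *)
Lemma S_openE x (w : fseq) : (Slevel x <= size w)%N ->
  (S_open x : ideal cantor_site) w <-> cmax w <= lend x.1 \/ rend x.2 <= cmin w.
Proof.
move=> xw; split; last first.
  case=> [/left_halfE h|/right_halfE h].
    exact: (@ole_ojoin2l Cantor (oapp up_left obot x.1)) h.
  exact: (@ole_ojoin2r Cantor (oapp up_left obot x.1)) h.
pose P w := cmax w <= lend x.1 \/ rend x.2 <= cmin w.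
pose A := [set u : fseq | forall w, prefix u w -> (Slevel x <= size w)%N -> P w].
have Pd u v : prefix u v -> P u -> P v.
  move=> uv [h|h]; [left; exact: le_trans (cmax_prefix uv) h|right].
  exact: le_trans h (cmin_prefix uv).
have iA : is_ideal (B := cantor_site) A.
  apply: is_ideal_cantor => [s t ts h v sv|s h v].
    by apply: h; apply: prefix_trans sv.
  move=> /prefix_rconsP[->|[b bv]]; last exact: h bv.
  move=> xs.
  have h0 b : P (rcons s b).
    by apply: (h b); rewrite ?prefix_refl// size_rcons; apply: leq_trans xs _.
  have := h0 false; have := h0 true.
  have := lend_grid xs; have := rend_grid xs; have := cmin_lt_cmax s.
  rewrite /P !cmin_rcons !cmax_rcons => ? h1 h2 h3 h4.
  (* The minus child decides: if it lies left of [lend x.1], this grid point exceeds [cmin s], so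
     all of [s] lies left of it; the other case holds because the child has the same [cmin] as
     [s]. *)
  case: h4 => ?; last by right.
  by case: h2 => ?; [lra|left].
suff sub : ole (S_open x) (Ideal iA : opens Cantor).
  by move=> /sub; apply=> //; apply: prefix_refl.
apply/ojoin2P; split=> u.
  by move=> /left_halfE h v uv _; apply: Pd uv _; left.
by move=> /right_halfE h v uv _; apply: Pd uv _; right.
Qed.

(** * Values of the right adjoint on the preframe base *)

(** Every deep cell lies on one side of the grid point [lend x.1], and both sides are covered. *)
Lemma forall_c_S_open_top x : rend x.2 <= lend x.1 -> forall_c (S_open x) = otop.
Proof.
move=> ba; apply: ideal_eq => u; split=> // _ s _.
apply: (@cantor_ideal_long (S_open x) (Slevel x)) => w _ xw.
apply/S_openE => //; have [h|h] := lend_grid xw; last by left.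
by right; apply: le_trans h.
Qed.

Lemma forall_c_S_open_apart x : lend x.1 < rend x.2 ->
  forall_c (S_open x) = ojoin2 (ivl_lt (lend x.1)) (ivl_gt (rend x.2)).
Proof.
have := lend_bound x.1; have := rend_bound x.2.
set a := lend x.1; set b := rend x.2 => b1 a1 ab.
apply: ole_anti; last first.
  apply/ojoin2P; split; apply/ojoinP => _ [r _ <-]; apply: basic_sub => s [/= h1 h2].
    apply: (@ole_ojoin2l Cantor (oapp up_left obot x.1)).
    by apply/left_halfE; apply: ltW.
  apply: (@ole_ojoin2r Cantor (oapp up_left obot x.1)).
  by apply/right_halfE; apply: ltW.
move=> [p q] h.
have [qp|pq] := leP q p; first exact: gen_cov (ivl_cov_empty qp) _.
have [q1|q1] := leP q (-1); first exact: gen_cov (ivl_cov_below p q1) _.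
have [p1|p1] := leP 1 p; first exact: gen_cov (ivl_cov_above q p1) _.
have [qa|aq] := leP q a.
  apply: (@ole_ojoin2l Interval (ivl_lt a)).
  apply: gen_in; exists (ivl p a); first by exists p.
  by apply: (@ideal_down _ (ivl p a) _ (p, a)); [split=> /=|exact: basic_in].
have [bp|pb] := leP b p.
  apply: (@ole_ojoin2r Interval (ivl_lt a)).
  apply: gen_in; exists (ivl b q); first by exists q.
  by apply: (@ideal_down _ (ivl b q) _ (b, q)); [split=> /=|exact: basic_in].
(* Now (p, q) meets the gap (a, b); a deep small cell inside the intersection contradicts
   [S_openE]. *)
exfalso; pose l := Num.max p a; pose r := Num.min q b.
have lr : l < r by rewrite lt_min !gt_max pq aq pb ab.
have [lp la] : p <= l /\ a <= l by rewrite /l !le_max !lexx orbT.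
have [rq rb] : r <= q /\ r <= b by rewrite /r !ge_min !lexx orbT.
have [||s [xs s1 s2 s3]] := @small_cell_of ((l + r) / 2) ((r - l) / 2) (Slevel x);
  [lra..|].
have /S_openE : (S_open x : ideal cantor_site) s by apply: h; split=> /=; lra.
by move=> /(_ xs)[]; rewrite -/a -/b; lra.
Qed.

(** * Numerical form of [between] and [theta] *)

Lemma cmin_eq_m1 t : (cmin t == -1) = (true \notin t).
Proof.
elim: t => [|b t IH] //; rewrite cmin_cons in_cons negb_or -IH.
have := cmin_ge t; case: b; rewrite /sgn /= => h; first by apply/eqP; lra.
by apply/eqP/eqP; lra.
Qed.

Lemma cmax_eq_1 s : (cmax s == 1) = (false \notin s).
Proof.
elim: s => [|b s IH] //; rewrite cmax_cons in_cons negb_or -IH.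
have := cmax_le s; case: b; rewrite /sgn /= => h; last by apply/eqP; lra.
by apply/eqP/eqP; lra.
Qed.

Lemma notin_nseq (b : bool) (s : fseq) : ~~ b \notin s -> s = nseq (size s) b.
Proof.
elim: s => //= d s IH; rewrite in_cons negb_or => /andP[bd /IH <-].
by congr cons; case: b d bd {IH} => [] [].
Qed.

Lemma betweenP s t : between s t <-> cmin t <= cmax s.
Proof.
split.
  case=> [[u [ut us]]|ts|st|[u [k [l [-> ->]]]]].
  - have := cmax_prefix ut; have := cmin_prefix us.
    have := cmin_lt_cmax s; have := cmin_lt_cmax t.
    by rewrite cmax_rcons cmin_rcons; lra.
  - by have := cmin_prefix ts; have := cmin_lt_cmax s; lra.
  - by have := cmax_prefix st; have := cmin_lt_cmax t; lra.
  - have e1 : cmax (nseq k true) = 1 by apply/eqP; rewrite cmax_eq_1 mem_nseq andbF.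
    have e2 : cmin (nseq l false) = -1 by apply/eqP; rewrite cmin_eq_m1 mem_nseq andbF.
    rewrite /cmin /cmax !cat_rcons !cval_cat /= -/(cmin _) -/(cmax _) e1 e2.
    by apply: cval_mono; rewrite /sgn; lra.
elim: s t => [|b s IH] [|d t]; try by [constructor 2|constructor 3].
rewrite cmin_cons cmax_cons => ts.
have := (cmin_ge t, cmax_le t, (cmin_ge s, cmax_le s)).
case=> -[t1 t2] [s1 s2].
have [e|bd] := eqVneq b d.
  rewrite -e in ts *.
  case: (IH t) => [|[u [ut us]]|h|h|[u [k [l [-> ->]]]]]; first lra.
  - by constructor 1; exists (b :: u); rewrite /= !eqxx.
  - by constructor 2; rewrite /= eqxx.
  - by constructor 3; rewrite /= eqxx.
  - by constructor 4; exists (b :: u), k, l.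
case: b bd ts; case: d => //= _; rewrite /sgn => ts.
  by constructor 1; exists [::]; rewrite /= !prefix0s.
(* Here [s] started with - and [t] with +, so their cells can only touch at a midpoint. This forces
   tails +^k and -^l, the two expansions of that point. *)
have /eqP : cmax s = 1 by lra.
have /eqP : cmin t = -1 by lra.
rewrite cmin_eq_m1 cmax_eq_1 => /(@notin_nseq false) -> /(@notin_nseq true) ->.
by constructor 4; exists [::], (size s), (size t).
Qed.

Lemma ivl_lt_obot : ivl_lt (-1) = obot.
Proof.
apply: ole_anti; last by apply/ojoinP.
apply/ojoinP => _ [p _ <-]; apply: basic_sub.
exact: gen_cov (ivl_cov_below p (lexx _)) _.
Qed.

Lemma ivl_gt_obot : ivl_gt 1 = obot.
Proof.
apply: ole_anti; last by apply/ojoinP.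
apply/ojoinP => _ [p _ <-]; apply: basic_sub.
exact: gen_cov (ivl_cov_above p (lexx _)) _.
Qed.

Lemma ojoin2_topl (X : locale) (a : opens X) : ojoin2 otop a = otop.
Proof. by apply: ole_anti; [exact: ole_top|exact: ole_ojoin2l]. Qed.

Lemma ojoin2_topr (X : locale) (a : opens X) : ojoin2 a otop = otop.
Proof. by apply: ole_anti; [exact: ole_top|exact: ole_ojoin2r]. Qed.

(** The end points -1 and 1 given to bottom absorb all cases of [theta]. When both components are
    sequences and [between] fails, cmax s < cmin t forces a - in [s] and a + in [t]. *)
Lemma thetaE x : theta x =
  if rend x.2 <= lend x.1 then otop else ojoin2 (ivl_lt (lend x.1)) (ivl_gt (rend x.2)).
Proof.
case: x => [[s|] [t|]] /=.
- have -> : `[< between s t >] = (cmin t <= cmax s).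
    by apply/asboolP/idP => /betweenP.
  case: leP => // st.
  have -> : true \in t.
    rewrite -[_ \in _]negbK -cmin_eq_m1; apply/eqP.
    by have := cmin_ge s; have := cmin_lt_cmax s; lra.
  have -> // : false \in s.
  rewrite -[_ \in _]negbK -cmax_eq_1; apply/eqP.
  by have := cmax_le t; have := cmin_lt_cmax t; lra.
- have -> : (1 <= cmax s) = (false \notin s) by rewrite -cmax_eq_1 eq_le cmax_le.
  rewrite /theta /= ivl_gt_obot; case: (false \in s) => //.
  exact: (ojoin2_topl (X := Interval)).
- have -> : (cmin t <= -1) = (true \notin t) by rewrite -cmin_eq_m1 eq_le cmin_ge andbT.
  rewrite /theta /= ivl_lt_obot; case: (true \in t) => //.
  exact: (ojoin2_topr (X := Interval)).
- by rewrite /theta /= ivl_lt_obot ivl_gt_obot.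
Qed.

Lemma forall_c_theta x : forall_c (S_open x) = theta x.
Proof.
rewrite thetaE; case: leP; first exact: forall_c_S_open_top.
exact: forall_c_S_open_apart.
Qed.

(** * Uniqueness *)

(** Finds a cell ending where that of [t] begins, or bottom if [t] begins at -1. The size bound
    keeps the [Slevel] of the complement at most [size t]. *)
Lemma pred_cell (t : fseq) :
  exists2 s, lend s = cmin t & (oapp size 0 s <= size t)%N.
Proof.
elim: t => [|b t [[s|] /= se st]]; first by exists None.
  by exists (Some (b :: s)) => //=; rewrite cmax_cons cmin_cons se.
(* The tail starts at -1, so + followed by it starts at 0, where the cell of - ends. *)
case: b; first by exists (Some [:: false]) => //=; rewrite cmin_cons -se.
by exists None => //=; rewrite cmin_cons -se.
Qed.

Lemma succ_cell (t : fseq) :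
  exists2 s, rend s = cmax t & (oapp size 0 s <= size t)%N.
Proof.
elim: t => [|b t [[s|] /= se st]]; first by exists None.
  by exists (Some (b :: s)) => //=; rewrite cmax_cons cmin_cons se.
case: b; first by exists None => //=; rewrite cmax_cons -se.
by exists (Some [:: true]) => //=; rewrite cmax_cons -se.
Qed.

Lemma cylinder_complement (t : fseq) : exists x : Sbase, forall w : fseq,
  (size t <= size w)%N -> (S_open x : ideal cantor_site) w <-> ~~ prefix t w.
Proof.
have [l lt ls] := pred_cell t; have [r rt rs] := succ_cell t.
exists (l, r) => w tw; rewrite S_openE /=; last first.
  by apply: leq_trans tw; rewrite geq_max ls rs.
rewrite lt rt; split=> [h|/negP nprefix]; last first.
  by case: (prefix_or_apart tw) => [/nprefix//|?|?]; [right|left].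
apply/negP => tw'; have := cmin_prefix tw'; have := cmax_prefix tw'.
by have := cmin_lt_cmax w; lra.
Qed.

Definition co_cylinder (t : fseq) : opens Cantor :=
  S_open (sval (cid (cylinder_complement t))).

Lemma co_cylinderE (t w : fseq) : (size t <= size w)%N ->
  (co_cylinder t : ideal cantor_site) w <-> ~~ prefix t w.
Proof. by rewrite /co_cylinder; case: cid => x /= h; apply: h. Qed.

(* The union of the cylinders of length [n] contained in [U], presented as the
   meet of the complements of the other cylinders of length [n]. *)
Definition approx (U : opens Cantor) (n : nat) : opens Cantor :=
  foldr omeet otop [seq co_cylinder (val t) | t <- enum {: n.-tuple bool} &
    ~~ `[< (U : ideal cantor_site) (val t) >]].

Lemma approxE (U : opens Cantor) n (w : fseq) :
  (approx U n : ideal cantor_site) w <->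
  forall t : fseq, size t = n -> ~ (U : ideal cantor_site) t ->
    (co_cylinder t : ideal cantor_site) w.
Proof.
have -> : (approx U n : ideal cantor_site) w <->
    forall t, t \in [seq t <- enum {: n.-tuple bool} |
      ~~ `[< (U : ideal cantor_site) (val t) >]] ->
    (co_cylinder (val t) : ideal cantor_site) w.
  rewrite /approx; elim: [seq t <- _ | _] => [|t ts IH] //=; split.
    by move=> [tw /IH h] t'; rewrite in_cons => /predU1P[->|/h].
  move=> h; split; first by apply: h; rewrite in_cons eqxx.
  by apply/IH => t' t'ts; apply: h; rewrite in_cons t'ts orbT.
split=> h t.
  move=> tn nU; have tn' : size t == n by apply/eqP.
  apply: (h (Tuple tn')); rewrite mem_filter mem_enum andbT.
  by apply/asboolPn.
rewrite mem_filter => /andP[/asboolPn nU _]; apply: h => //.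
by rewrite size_tuple.
Qed.

(** Of the cylinders of length [n], only that of [take n w] contains [w], so only its complement
    could exclude [w] from the meet. *)
Lemma approx_long (U : opens Cantor) n (w : fseq) : (n <= size w)%N ->
  (approx U n : ideal cantor_site) w <-> (U : ideal cantor_site) (take n w).
Proof.
move=> nw; rewrite approxE; split=> [h|Uw t tn nU].
  apply: contrapT => nU; have := h _ (size_takel nw) nU.
  have tw : prefix (take n w) w by rewrite -{2}(cat_take_drop n w) prefix_prefix.
  by move=> /co_cylinderE; rewrite tw size_takel// => /(_ nw).
apply/co_cylinderE; first by rewrite tn.
by apply/negP => /prefixP[v wv]; apply: nU; move: Uw; rewrite wv take_size_cat.
Qed.

Lemma approx_mono (U : opens Cantor) m n : (m <= n)%N ->
  ole (approx U m) (approx U n).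
Proof.
move=> mn w Uw; apply: (@cantor_ideal_long (approx U n) n) => v wv nv.
have /approx_long := @ideal_down cantor_site (approx U m) v w wv Uw.
move=> /(_ (leq_trans mn nv)) Uv; apply/approx_long => //.
apply: (@ideal_down cantor_site U _ _ _ Uv).
rewrite /= /cantor_le -(take_takel _ mn).
by rewrite -{2}(cat_take_drop m (take n v)) prefix_prefix.
Qed.

Lemma approx_directed (U : opens Cantor) : directed (range (approx U)).
Proof.
split=> [|_ _ [m _ <-] [n _ <-]]; first by exists (approx U 0), 0%N.
exists (approx U (maxn m n)); split; first by exists (maxn m n).
  by apply: approx_mono; apply: leq_maxl.
by apply: approx_mono; apply: leq_maxr.
Qed.

Lemma approx_join (U : opens Cantor) : ojoin (range (approx U)) = U.
Proof.
apply: ole_anti => [|s Us].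
  apply/ojoinP => _ [n _ <-] w Uw; apply: (@cantor_ideal_long U n) => v wv nv.
  have /approx_long := @ideal_down cantor_site (approx U n) v w wv Uw.
  move=> /(_ nv); apply: (@ideal_down cantor_site U).
  by rewrite /= /cantor_le -{2}(cat_take_drop n v) prefix_prefix.
apply: gen_in; exists (approx U (size s)); first by exists (size s).
by apply/approx_long => //; rewrite take_size.
Qed.

Lemma preframe_hom_eq (Y : locale) (F G : opens Cantor -> opens Y) :
  preframe_hom F -> preframe_hom G ->
  (forall x, F (S_open x) = G (S_open x)) -> F = G.
Proof.
move=> [F1 F2 F3] [G1 G2 G3] FG; apply/funext => U.
have FGapprox n : F (approx U n) = G (approx U n).
  rewrite /approx; elim: [seq t <- _ | _] => [|t ts IH] /=; first by rewrite F1 G1.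
  by rewrite F2 G2 IH; congr omeet; apply: FG.
rewrite -(approx_join U) F3 ?G3; try exact: approx_directed.
by congr ojoin; rewrite !image_comp; apply: eq_imagel => n _; apply: FGapprox.
Qed.

Theorem theorem6p7 :
  surjection cmap /\
  proper cmap /\
  exists forall_c : opens Cantor -> opens Interval,
    unique (fun F : opens Cantor -> opens Interval =>
              preframe_hom F /\ (forall x : Sbase, F (S_open x) = theta x))
           forall_c /\
    right_adjoint (pullback cmap) forall_c.
Proof.
split; first exact: cmap_surjection.
split; first exact: cmap_proper.
exists forall_c; split; last exact: forall_c_adjoint.
split; first by split; [exact: forall_c_preframe|exact: forall_c_theta].
move=> F [hF Ftheta]; apply: preframe_hom_eq hF _; first exact: forall_c_preframe.
by move=> x; rewrite forall_c_theta Ftheta.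
Qed.
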